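(* Let $n\ge 3$, let $T>0$, and let $(S^1(T)\times S^{n-1},\, g_0=dt^2+d\xi^2)$ be the Riemannian product of a circle of length $T$ and the Euclidean unit sphere $S^{n-1}$. Let $k\ge 1$ be an integer and suppose that $$\frac{2\pi (k-1)}{\sqrt{n-2}} < T \le \frac{2\pi k}{\sqrt{n-2}}.$$ Then there exist, in the conformal class $[g_0]$, $k$ rotationally invariant pseudo-cylindric metrics $$g^j=(u^j)^{\frac{4}{n-2}}(dt^2+d\xi^2),\qquad j=0,1,\dots,k-1,$$ pairwise not related by a translation of the variable $t$, where $g^0$ is a constant multiple of $g_0$. When $k=1$, the only pseudo-cylindric metric is the trivial product metric, i.e. a constant multiple of $dt^2+d\xi^2$.
   Context: $d\xi^2$ is the standard metric on the unit sphere $S^{n-1}$, and $t$ is the arc length coordinate on the circle $S^1(T)$ of length $T$. The conformal class of $g_0$ is denoted $[g_0]$. A pseudo-cylindric metric on $S^1(T)\times S^{n-1}$ is a metric $u^{\frac{4}{n-2}}(dt^2+d\xi^2)$, where $u=u(t)$ is a smooth positive $T$-periodic function of $t$ alone (this is the meaning of rotationally invariant) satisfying $$u''-\frac{(n-2)^2}{4}u+\frac{n(n-2)}{4}u^{\frac{n+2}{n-2}}=0,$$ equivalently such that the metric has constant scalar curvature $n(n-1)$. The constant solution $u\equiv\left(\frac{n-2}{n}\right)^{\frac{n-2}{4}}$ gives the trivial (cylindric) metric. Two solutions which differ by a translation of $t$ give equivalent metrics and are not counted as different. *)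

(* Defs.v *)
From Stdlib Require Import Reals.
From Coquelicot Require Import Coquelicot.
From mathcomp Require Import all_boot.

Set Implicit Arguments.
Unset Strict Implicit.
Unset Printing Implicit Defensive.

Local Open Scope R_scope.

(* The circle S^1(T) is R / TZ with its arc length coordinate t, and S^(n-1)
   is the unit sphere of Euclidean R^n.  Everything on S^1(T) is lifted to a
   T-periodic object on R. *)

Definition vec (n : nat) := 'I_n -> R.

Definition dot (n : nat) (v w : vec n) : R :=
  \big[Rplus/0]_(i < n) (v i * w i).

Definition on_sphere (n : nat) (xi : vec n) : Prop := dot xi xi = 1.

(* A tangent vector at (t, xi) is a pair (a, v) standing for a d/dt + v, where
   v is a vector of R^n orthogonal to xi. *)
Definition tvec (n : nat) := (R * vec n)%type.

Definition tangent (n : nat) (xi : vec n) (X : tvec n) : Prop :=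
  dot xi X.2 = 0.

(* A field of bilinear forms: g t xi X Y is the value of g at the point (t, xi)
   on X and Y.  It is meaningful only for xi on the sphere and X, Y tangent at
   (t, xi), so equality of fields is tested only there. *)
Definition form_field (n : nat) := R -> vec n -> tvec n -> tvec n -> R.

Definition form_eq (n : nat) (g h : form_field n) : Prop :=
  forall (t : R) (xi : vec n) (X Y : tvec n),
    on_sphere xi -> tangent xi X -> tangent xi Y -> g t xi X Y = h t xi X Y.

(* dt^2 + dxi^2; the metric dxi^2 is induced by the Euclidean metric of R^n. *)
Definition g0 (n : nat) : form_field n :=
  fun _ _ X Y => X.1 * Y.1 + dot X.2 Y.2.

Definition conformal_metric (n : nat) (u : R -> R) : form_field n :=
  fun t xi X Y => Rpower (u t) (4 / (INR n - 2)) * g0 t xi X Y.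

Definition constant_multiple_of_g0 (n : nat) (g : form_field n) : Prop :=
  exists c : R, 0 < c /\ form_eq g (fun t xi X Y => c * g0 t xi X Y).

(* The pullback of g by (t, xi) |-> (t + tau, xi). *)
Definition translate (n : nat) (tau : R) (g : form_field n) : form_field n :=
  fun t => g (t + tau).

Definition translation_related (n : nat) (g h : form_field n) : Prop :=
  exists tau : R, form_eq h (translate tau g).

Definition smooth (u : R -> R) : Prop :=
  forall (m : nat) (t : R), ex_derive_n u m t.

Definition pseudo_cylindric_factor (n : nat) (T : R) (u : R -> R) : Prop :=
  [/\ smooth u,
      forall t : R, 0 < u t,
      forall t : R, u (t + T) = u t
    & forall t : R,
        Derive_n u 2 t - (INR n - 2) ^ 2 / 4 * u t
        + INR n * (INR n - 2) / 4
          * Rpower (u t) ((INR n + 2) / (INR n - 2)) = 0].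

Definition pseudo_cylindric_metric (n : nat) (T : R) (g : form_field n) :
    Prop :=
  exists u : R -> R,
    pseudo_cylindric_factor n T u /\ form_eq g (conformal_metric u).

(* Main.v *)
Require Import Defs.
From Stdlib Require Import Reals Lra Psatz IndefiniteDescription Ranalysis5.
From Coquelicot Require Import Coquelicot.
From mathcomp Require Import all_boot.

(** Write the equation as [u'' = a u - b u^p] with [a = (n - 2)^2 / 4],
    [b = n (n - 2) / 4] and [p = (n + 2) / (n - 2)], and put [q = p + 1].
    It conserves [u'^2 / a - (u^2 - u^q)].

    Existence.  The potential [u^2 - u^q] has a nondegenerate maximum [m^2] at
    the constant solution, so by the Morse lemma [m^2 - (u^2 - u^q) = y^2] for
    a regular coordinate [y] ([morse_coordinate], [energy_chart]).  Conservation
    of energy becomes [y = r sin th], [u' = sqrt a r cos th], and an orbit of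
    amplitude [r] is obtained by inverting the integral that gives the time as
    a function of the angle ([circle_clock], [phase_solution]).  Its period is
    the integral over one turn of [H (r sin th) / sqrt a], where
    [H = du / dy].  This involves no improper integral and is visibly continuous
    in [r]; it is [2 PI / sqrt (n - 2)] at [r = 0] and unbounded as the orbit
    approaches the homoclinic one ([angle_integral_ge]).  Hence every
    [T / j > 2 PI / sqrt (n - 2)] is a period, which for [0 < j < k] is
    the hypothesis on [T].  The maximum of [u] determines [r] and thus [j], so
    the solutions are not translates of one another
    ([pseudo_cylindric_family]).

    Uniqueness for [k = 1].  Multiplying the equation by [u''] and by
    [p u'^2 / u], adding, and integrating over a period gives
    [int u''^2 + (p / 3) int u'^4 / u^2 = (n - 2) int u'^2].  As [u'] has mean
    zero, the Wirtinger inequality bounds [int u''^2] below by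
    [(2 PI / T)^2 int u'^2], and [(2 PI / T)^2 >= n - 2] then forces [u' = 0].
    [rigidity] carries this out with the two half periods treated separately
    ([half_period_estimate]). *)

Set Implicit Arguments.
Unset Strict Implicit.
Unset Printing Implicit Defensive.

Local Open Scope R_scope.

(** * Derivatives, monotonicity and inverse functions *)

Lemma le_of_derive_ge0 (f df : R -> R) (a b : R) :
  a <= b ->
  (forall x, a <= x <= b -> is_derive f x (df x)) ->
  (forall x, a <= x <= b -> 0 <= df x) ->
  f a <= f b.
Proof.
move=> hab hd hp.
have [||c [hc e]] := MVT_gen f a b df.
- by move=> x; rewrite Rmin_left // Rmax_right // => hx; apply: hd; lra.
- rewrite Rmin_left // Rmax_right // => x hx.
  apply: derivable_continuous_pt; exists (df x).
  by apply/is_derive_Reals/hd.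
move: hc; rewrite Rmin_left // Rmax_right // => hc.
have := hp c hc; nra.
Qed.

Lemma lt_of_derive_gt0 (f df : R -> R) (a b : R) :
  a < b ->
  (forall x, a <= x <= b -> is_derive f x (df x)) ->
  (forall x, a <= x <= b -> 0 < df x) ->
  f a < f b.
Proof.
move=> hab hd hp.
have [||c [hc e]] := MVT_gen f a b df.
- by move=> x; rewrite Rmin_left ?Rmax_right; try lra; move=> hx; apply: hd; lra.
- rewrite Rmin_left ?Rmax_right; try lra; move=> x hx.
  apply: derivable_continuous_pt; exists (df x).
  by apply/is_derive_Reals/hd.
move: hc; rewrite Rmin_left ?Rmax_right; try lra; move=> hc.
have := hp c hc; nra.
Qed.

Lemma is_derive_epsP (f : R -> R) (x l : R) :
  is_derive f x l <->
  forall eps, 0 < eps -> exists d, 0 < d /\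
    forall y, Rabs (y - x) < d ->
      Rabs (f y - f x - l * (y - x)) <= eps * Rabs (y - x).
Proof.
rewrite is_derive_Reals; split.
- move=> h eps he; have [d hd] := h eps he.
  exists d; split; first exact: cond_pos.
  move=> y hy.
  case: (Req_dec (y - x) 0) => [e|ne].
    have -> : y = x by lra.
    by rewrite !Rminus_diag Rmult_0_r Rminus_0_r Rabs_R0; lra.
  have := hd (y - x) ne hy.
  have -> : x + (y - x) = y by ring.
  have -> : f y - f x - l * (y - x) = ((f y - f x) / (y - x) - l) * (y - x)
    by field.
  rewrite Rabs_mult => h1.
  by apply: Rmult_le_compat_r; [exact: Rabs_pos | lra].
- move=> h eps he; have [|d [hd h1]] := h (eps / 2); first by lra.
  exists (mkposreal d hd) => z nz /= hz.
  have := h1 (x + z).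
  have -> : x + z - x = z by ring.
  move=> /(_ hz).
  have -> : f (x + z) - f x - l * z = ((f (x + z) - f x) / z - l) * z by field.
  rewrite Rabs_mult => h2.
  have := Rabs_pos_lt z nz => h3.
  have h4 := Rmult_le_reg_r _ _ _ h3 h2.
  by lra.
Qed.

Lemma continuous_of_derive (f : R -> R) (x l : R) :
  is_derive f x l -> continuous f x.
Proof. by move=> h; apply: ex_derive_continuous; exists l. Qed.

Lemma continuity_of_continuous (f : R -> R) :
  (forall x, continuous f x) -> continuity f.
Proof. by move=> h x; apply/continuity_pt_filterlim/h. Qed.

Lemma continuous_epsP (f : R -> R) (x : R) :
  continuous f x <->
  forall eps, 0 < eps -> exists d, 0 < d /\
    forall y, Rabs (y - x) < d -> Rabs (f y - f x) < eps.
Proof.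
split.
- move=> h eps he.
  have [d hd] : locally x (fun y => ball (f x) (mkposreal eps he) (f y)).
    by apply: (h (fun z => ball (f x) (mkposreal eps he) z)); exists (mkposreal eps he).
  by exists d; split; [exact: cond_pos | move=> y hy; apply: (hd y)].
- move=> h P [[e he] hP].
  have [d [hd h1]] := h e he.
  exists (mkposreal d hd) => y hy; apply: hP; exact: h1.
Qed.

(** As [f] is strictly increasing, its values at [g y0 - eps] and [g y0 + eps]
    enclose all [y] near [y0], so [g] is continuous at [y0]; the first order
    expansion of [f] at [g y0] can then be read backwards. *)
Lemma is_derive_right_inverse (f df g : R -> R) (y0 : R) :
  (forall x, is_derive f x (df x)) -> (forall x, 0 < df x) ->
  (exists d, 0 < d /\ forall y, Rabs (y - y0) < d -> f (g y) = y) ->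
  is_derive g y0 (/ df (g y0)).
Proof.
move=> hd hp [d0 [hd0 hg]].
have hinc x x' : x < x' -> f x < f x'.
  by move=> hx; apply: (@lt_of_derive_gt0 f df) => // z _.
have e0 : f (g y0) = y0 by apply: hg; rewrite Rminus_diag Rabs_R0.
set x0 := g y0 in e0 *.
(* an increasing function has a continuous right inverse *)
have hc eps : 0 < eps -> exists d, 0 < d /\ d <= d0 /\
    forall y, Rabs (y - y0) < d -> Rabs (g y - x0) < eps.
  move=> he.
  have h1 := hinc (x0 - eps) x0 ltac:(lra).
  have h2 := hinc x0 (x0 + eps) ltac:(lra).
  exists (Rmin d0 (Rmin (y0 - f (x0 - eps)) (f (x0 + eps) - y0))).
  split; first by apply: Rmin_pos => //; apply: Rmin_pos; lra.
  split; first exact: Rmin_l.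
  move=> y hy.
  have a1 := Rmin_l d0 (Rmin (y0 - f (x0 - eps)) (f (x0 + eps) - y0)).
  have a2 := Rmin_r d0 (Rmin (y0 - f (x0 - eps)) (f (x0 + eps) - y0)).
  have a3 := Rmin_l (y0 - f (x0 - eps)) (f (x0 + eps) - y0).
  have a4 := Rmin_r (y0 - f (x0 - eps)) (f (x0 + eps) - y0).
  have ey := hg y ltac:(lra).
  move/Rabs_def2: hy => hy.
  apply: Rabs_def1.
  - case: (Rlt_or_le (g y) (x0 + eps)) => [|hle]; first lra.
    case: hle => [hlt|e]; last by have := f_equal f e; lra.
    have := hinc _ _ hlt; lra.
  - case: (Rlt_or_le (x0 - eps) (g y)) => [|hle]; first lra.
    case: hle => [hlt|e]; last by have := f_equal f e; lra.
    have := hinc _ _ hlt; lra.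
apply/is_derive_epsP => eps he.
have hdp := hp x0.
set D := df x0 in hdp *.
pose eta := Rmin (D / 2) (eps * D ^ 2 / 2).
have hD2 : 0 < eps * D ^ 2 by apply: Rmult_lt_0_compat => //; nra.
have heta : 0 < eta by apply: Rmin_pos; lra.
have heta1 : eta <= D / 2 := Rmin_l _ _.
have heta2 : eta <= eps * D ^ 2 / 2 := Rmin_r _ _.
have /is_derive_epsP/(_ eta heta) [d1 [hd1 h1]] := hd x0.
have [d2 [hd2 [hd20 h2]]] := hc d1 hd1.
exists d2; split => // y hy.
have := h1 (g y) (h2 y hy).
rewrite hg; last lra.
rewrite e0 -/D -/x0.
set w := y - y0; set z := g y - x0 => h3.
have h4 : D * Rabs z <= Rabs w + eta * Rabs z.
  have -> : D * Rabs z = Rabs (D * z) by rewrite Rabs_mult (Rabs_pos_eq D); lra.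
  have -> : D * z = w - (w - D * z) by ring.
  apply: Rle_trans (Rabs_triang _ _) _; rewrite Rabs_Ropp; lra.
have hz := Rabs_pos z.
have hw := Rabs_pos w.
have h5 : D * Rabs z <= 2 * Rabs w by nra.
have -> : z - / D * w = - ((w - D * z) / D) by field; lra.
rewrite Rabs_Ropp /Rdiv Rabs_mult (Rabs_pos_eq (/ D)); last first.
  by left; apply: Rinv_0_lt_compat.
apply: (Rmult_le_reg_r D) => //.
rewrite Rmult_assoc Rinv_l; last lra.
rewrite Rmult_1_r.
apply: Rle_trans h3 _.
apply: (Rle_trans _ (eps * D * (D * Rabs z) / 2)).
  have := Rmult_le_compat_r _ _ _ hz heta2; lra.
have : 0 < eps * D by nra.
nra.
Qed.

(** * The Morse lemma in dimension one *)

Lemma mvt_between (f f' : R -> R) (x0 x : R) :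
  (forall z, is_derive f z (f' z)) -> x <> x0 ->
  exists c, f x - f x0 = f' c * (x - x0) /\ 0 < (c - x0) * (x - x0) /\
    Rabs (c - x0) < Rabs (x - x0).
Proof.
move=> hd hx.
case: (Rtotal_order x x0) => [hlt|[//|hlt]].
- have [c [e hc]] := MVT_cor2 f f' x x0 hlt (fun z _ => proj1 (is_derive_Reals _ _ _) (hd z)).
  exists c; split; first lra.
  split; first nra.
  by rewrite !Rabs_left; lra.
- have [c [e hc]] := MVT_cor2 f f' x0 x hlt (fun z _ => proj1 (is_derive_Reals _ _ _) (hd z)).
  exists c; split; first lra.
  split; first nra.
  by rewrite !Rabs_right; lra.
Qed.

(** The quadratic expansion of [V] at its critical point, obtained with only a
    first derivative of [V1] at that one point. *)
Lemma morse_second_order (V V1 : R -> R) (x0 v : R) :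
  (forall x, is_derive V x (V1 x)) -> is_derive V1 x0 v ->
  V x0 = 0 -> V1 x0 = 0 ->
  forall eps, 0 < eps -> exists d, 0 < d /\
    forall x, Rabs (x - x0) < d ->
      Rabs (V x - v / 2 * (x - x0) ^ 2) <= eps * (x - x0) ^ 2 /\
      Rabs (V1 x - v * (x - x0)) <= eps * Rabs (x - x0).
Proof.
move=> hV /is_derive_epsP hV1 e0 e1 eps he.
have [d [hd h1]] := hV1 eps he.
exists d; split=> // x hx.
have h2 z : Rabs (z - x0) < d -> Rabs (V1 z - v * (z - x0)) <= eps * Rabs (z - x0).
  by move=> hz; have := h1 z hz; rewrite e1 Rminus_0_r.
split; last exact: h2.
case: (Req_dec x x0) => [->|ne].
  by rewrite e0 Rminus_diag !pow_i ?Rmult_0_r ?Rminus_diag ?Rabs_R0; try lra; apply/ltP.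
(* Cauchy's mean value theorem for V against the square of x - x0 *)
have [||c [hc [hs hlt]]] := @mvt_between (fun z => V z * (x - x0) ^ 2 - V x * (z - x0) ^ 2)
  (fun z => V1 z * (x - x0) ^ 2 - V x * (2 * (z - x0))) x0 x => //.
  move=> z; auto_derive; first by exists (V1 z).
  by rewrite (is_derive_unique _ _ _ (hV z)); ring.
have hc1 : V1 c * (x - x0) ^ 2 - V x * (2 * (c - x0)) = 0.
  apply: (Rmult_eq_reg_r (x - x0)); last lra.
  by rewrite -hc e0; ring.
have := h2 c ltac:(lra) => h3.
have hc0 : c - x0 <> 0 by move=> e; rewrite e in hs; lra.
have -> : V x - v / 2 * (x - x0) ^ 2 =
    (V1 c - v * (c - x0)) * ((x - x0) ^ 2 * / (2 * (c - x0))).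
  have -> : V x = V1 c * (x - x0) ^ 2 / (2 * (c - x0)).
    apply: (Rmult_eq_reg_r (2 * (c - x0))); last lra.
    by field_simplify; lra.
  by field.
rewrite Rabs_mult.
have hp : 0 < Rabs (c - x0) by apply: Rabs_pos_lt.
have -> : Rabs ((x - x0) ^ 2 * / (2 * (c - x0))) = (x - x0) ^ 2 / 2 * / Rabs (c - x0).
  rewrite Rabs_mult Rabs_inv Rabs_mult (Rabs_pos_eq 2); last lra.
  rewrite Rabs_pos_eq; last exact: pow2_ge_0.
  by field; lra.
have hq := pow2_ge_0 (x - x0).
apply: (Rle_trans _ (eps * Rabs (c - x0) * ((x - x0) ^ 2 / 2 * / Rabs (c - x0)))).
  apply: Rmult_le_compat_r => //.
  apply: Rmult_le_pos; first lra.
  by left; apply: Rinv_0_lt_compat.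
have -> : eps * Rabs (c - x0) * ((x - x0) ^ 2 / 2 * / Rabs (c - x0)) =
  eps * (x - x0) ^ 2 / 2 by field; lra.
have : 0 <= eps * (x - x0) ^ 2 by apply: Rmult_le_pos; lra.
lra.
Qed.

(** The Morse lemma in dimension one: a potential with a single nondegenerate
    minimum is the square of a coordinate [G].  The signed square root of [V]
    is clearly differentiable away from [x0]; the content is that it remains
    continuously differentiable, with positive derivative, through [x0]. *)
Lemma morse_coordinate (V V1 : R -> R) (x0 v : R) :
  (forall x, is_derive V x (V1 x)) -> (forall x, continuous V1 x) ->
  is_derive V1 x0 v -> 0 < v -> V x0 = 0 -> V1 x0 = 0 ->
  (forall x, x <> x0 -> 0 < V1 x * (x - x0)) ->
  exists G g : R -> R,
    (forall x, is_derive G x (g x)) /\ (forall x, 0 < g x) /\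
    (forall x, continuous g x) /\ (forall x, G x ^ 2 = V x) /\
    (forall x, 2 * G x * g x = V1 x) /\ G x0 = 0 /\ g x0 = sqrt (v / 2).
Proof.
move=> hV hV1c hV1 hv e0 e1 hs.
have hVp x : x <> x0 -> 0 < V x.
  move=> ne; have [c [e [h1 h2]]] := mvt_between hV ne.
  have hc : c <> x0 by move=> ec; move: h1; rewrite ec; lra.
  have := hs c hc => h3.
  rewrite e0 Rminus_0_r in e; rewrite e.
  apply: (Rmult_lt_reg_r ((c - x0) ^ 2)); first by apply: pow2_gt_0; lra.
  have -> : V1 c * (x - x0) * (c - x0) ^ 2 =
    (V1 c * (c - x0)) * ((c - x0) * (x - x0)) by ring.
  by rewrite Rmult_0_l; apply: Rmult_lt_0_compat.
pose s := sqrt (v / 2).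
have hsp : 0 < s by apply: sqrt_lt_R0; lra.
have hss : s ^ 2 = v / 2 by rewrite /s pow2_sqrt; lra.
pose G x := if Rlt_dec x x0 then - sqrt (V x) else sqrt (V x).
have hG2 x : G x ^ 2 = V x.
  have hp : 0 <= V x.
    by case: (Req_dec x x0) => [->|ne]; [|have := hVp x ne]; lra.
  rewrite /G; case: Rlt_dec => h; last by rewrite pow2_sqrt.
  by rewrite -Rsqr_pow2 -Rsqr_neg Rsqr_sqrt.
have hG0 : G x0 = 0.
  by have := hG2 x0; rewrite e0 => h; apply: Rsqr_0_uniq; rewrite Rsqr_pow2.
have hGn x : x <> x0 -> G x <> 0.
  by move=> /hVp h1 h2; have := hG2 x; rewrite h2; lra.
have hGs x : 0 <= G x * (x - x0).
  have := sqrt_pos (V x); rewrite /G; case: Rlt_dec => /= h1 h2; first nra.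
  by have h3 := Rnot_lt_le _ _ h1; nra.
pose g x := if Req_dec_T x x0 then s else V1 x / (2 * G x).
have hg0 : g x0 = s by rewrite /g; case: Req_dec_T.
have hg x : x <> x0 -> g x = V1 x / (2 * G x).
  by rewrite /g; case: Req_dec_T.
have hGg x : 2 * G x * g x = V1 x.
  case: (Req_dec x x0) => [->|ne]; first by rewrite hG0 e1; ring.
  by rewrite hg //; field; apply: hGn.
(* first order behaviour of G at x0 *)
have hG1 eps : 0 < eps -> exists d, 0 < d /\ forall x, Rabs (x - x0) < d ->
    Rabs (G x - s * (x - x0)) <= eps * Rabs (x - x0) /\
    Rabs (V1 x - v * (x - x0)) <= eps * Rabs (x - x0).
  move=> he.
  have h : 0 < Rmin eps (eps * s) by apply: Rmin_pos => //; nra.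
  have hl := Rmin_l eps (eps * s); have hr := Rmin_r eps (eps * s).
  have [d [hd h1]] := morse_second_order hV hV1 e0 e1 h.
  exists d; split=> // x hx.
  have [h2 h3] := h1 x hx.
  have ha := Rabs_pos (x - x0).
  split; last first.
    by apply: Rle_trans h3 _; apply: Rmult_le_compat_r.
  case: (Req_dec x x0) => [->|ne].
    by rewrite hG0 Rminus_diag Rmult_0_r Rminus_0_r Rabs_R0; lra.
  have hp : 0 < Rabs (x - x0) by apply: Rabs_pos_lt; lra.
  have e2 : V x - v / 2 * (x - x0) ^ 2 = (G x - s * (x - x0)) * (G x + s * (x - x0)).
    by rewrite -hG2 -hss; ring.
  have h4 : s * Rabs (x - x0) <= Rabs (G x + s * (x - x0)).
    (* both terms have the sign of x - x0, so they do not cancel *)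
    have hGx := hGs x.
    move: hGx hp; rewrite /Rabs.
    by case: Rcase_abs => h5; case: Rcase_abs => h6; nra.
  move: h2; rewrite e2 Rabs_mult => h2.
  have h7 := Rabs_pos (G x - s * (x - x0)).
  have e3 : (x - x0) ^ 2 = Rabs (x - x0) * Rabs (x - x0).
    by rewrite -Rabs_mult Rabs_pos_eq; nra.
  apply: (Rmult_le_reg_r (s * Rabs (x - x0))); first nra.
  apply: (Rle_trans _ (Rabs (G x - s * (x - x0)) * Rabs (G x + s * (x - x0)))).
    by apply: Rmult_le_compat_l.
  apply: Rle_trans h2 _; rewrite e3; nra.
have hGd x : is_derive G x (g x).
  case: (Rtotal_order x x0) => [hlt|[->|hlt]].
  - have ne : x <> x0 by lra.
    apply: (is_derive_ext_loc (fun z => - sqrt (V z))).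
      have hp : 0 < x0 - x by lra.
      exists (mkposreal _ hp) => z /Rabs_def2 hz.
      rewrite /minus /plus /opp /= in hz.
      by rewrite /G; case: Rlt_dec => //= h0; lra.
    auto_derive; first by split; [exists (V1 x) | split => //; apply: hVp].
    rewrite (is_derive_unique _ _ _ (hV x)) hg // /G.
    have : 0 < sqrt (V x) by apply/sqrt_lt_R0/hVp.
    by case: Rlt_dec => //= h0 h; field; lra.
  - rewrite hg0; apply/is_derive_epsP => eps he.
    have [d [hd h1]] := hG1 eps he.
    exists d; split=> // y hy; rewrite hG0 Rminus_0_r.
    by case: (h1 y hy).
  - have ne : x <> x0 by lra.
    apply: (is_derive_ext_loc (fun z => sqrt (V z))).
      have hp : 0 < x - x0 by lra.
      exists (mkposreal _ hp) => z /Rabs_def2 hz.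
      rewrite /minus /plus /opp /= in hz.
      by rewrite /G; case: Rlt_dec => //= h0; lra.
    auto_derive; first by split; [exists (V1 x) | split => //; apply: hVp].
    rewrite (is_derive_unique _ _ _ (hV x)) hg // /G.
    have : 0 < sqrt (V x) by apply/sqrt_lt_R0/hVp.
    by case: Rlt_dec => /= h0 h; [lra | field; lra].
exists G, g; split=> //; split.
  move=> x; case: (Req_dec x x0) => [->|ne]; first by rewrite hg0.
  rewrite hg //.
  have h1 := hs x ne; have h2 := hGs x; have h3 := hGn x ne.
  have h4 : 0 < G x ^ 2 by apply: pow2_gt_0.
  have h5 : 0 < G x * V1 x.
    apply: (Rmult_lt_reg_r ((x - x0) ^ 2)); first by apply: pow2_gt_0; lra.
    have -> : G x * V1 x * (x - x0) ^ 2 = (V1 x * (x - x0)) * (G x * (x - x0)) by ring.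
    rewrite Rmult_0_l; apply: Rmult_lt_0_compat => //.
    case: h2 => // /esym h2.
    by case: (Rmult_integral _ _ h2) => //; lra.
  have -> : V1 x / (2 * G x) = (G x * V1 x) / (2 * G x ^ 2) by field.
  by apply: Rdiv_lt_0_compat; lra.
split; last by [].
move=> x; case: (Req_dec x x0) => [->|ne].
  apply/continuous_epsP => eps he; rewrite hg0.
  pose e' := Rmin (s / 2) (Rmin (eps * s / 4) (eps / 4)).
  have he' : 0 < e' by apply: Rmin_pos; [lra | apply: Rmin_pos; nra].
  have l1 : e' <= s / 2 by apply: Rmin_l.
  have l2 : e' <= eps * s / 4 by apply: Rle_trans (Rmin_r _ _) (Rmin_l _ _).
  have l3 : e' <= eps / 4 by apply: Rle_trans (Rmin_r _ _) (Rmin_r _ _).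
  have [d [hd h1]] := hG1 e' he'.
  exists d; split=> // y hy.
  case: (Req_dec y x0) => [->|ne].
    by rewrite hg0 Rminus_diag Rabs_R0.
  have [h2 h3] := h1 y hy.
  have hn := hGn y ne.
  have hp : 0 < Rabs (y - x0) by apply: Rabs_pos_lt; lra.
  have hpG : 0 < Rabs (G y) by apply: Rabs_pos_lt.
  have h4 : s / 2 * Rabs (y - x0) <= Rabs (G y).
    have h5 : s * Rabs (y - x0) <= Rabs (G y) + Rabs (G y - s * (y - x0)).
      have -> : s * Rabs (y - x0) = Rabs (G y - (G y - s * (y - x0))).
        rewrite -{1}(Rabs_pos_eq s); last lra.
        by rewrite -Rabs_mult; f_equal; ring.
      by apply: Rle_trans (Rabs_triang _ _) _; rewrite Rabs_Ropp; lra.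
    by nra.
  have h5 : Rabs (V1 y - 2 * s * G y) <= (1 + 2 * s) * (e' * Rabs (y - x0)).
    have -> : V1 y - 2 * s * G y = (V1 y - v * (y - x0)) - 2 * s * (G y - s * (y - x0)).
      have -> : v = 2 * s ^ 2 by lra.
      by ring.
    apply: Rle_trans (Rabs_triang _ _) _; rewrite Rabs_Ropp Rabs_mult (Rabs_pos_eq (2 * s)); last lra.
    have : 2 * s * Rabs (G y - s * (y - x0)) <= 2 * s * (e' * Rabs (y - x0)).
      by apply: Rmult_le_compat_l; lra.
    lra.
  rewrite hg //.
  have -> : V1 y / (2 * G y) - s = (V1 y - 2 * s * G y) * / (2 * G y) by field.
  rewrite Rabs_mult Rabs_inv Rabs_mult (Rabs_pos_eq 2); last lra.
  apply: (Rmult_lt_reg_r (2 * Rabs (G y))); first lra.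
  rewrite Rmult_assoc Rinv_l ?Rmult_1_r; last lra.
  apply: Rle_lt_trans h5 _.
  apply: (Rlt_le_trans _ (eps * (2 * (s / 2 * Rabs (y - x0))))); last first.
    by apply: Rmult_le_compat_l; lra.
  have -> : (1 + 2 * s) * (e' * Rabs (y - x0)) = (e' + 2 * s * e') * Rabs (y - x0) by ring.
  have -> : eps * (2 * (s / 2 * Rabs (y - x0))) = (eps * s) * Rabs (y - x0) by field.
  apply: Rmult_lt_compat_r => //.
  have : s * e' <= s * (eps / 4) by apply: Rmult_le_compat_l; lra.
  have : 0 < eps * s by apply: Rmult_lt_0_compat.
  by lra.
apply: (continuous_ext_loc _ (fun z => V1 z * / (2 * G z))).
  have hp : 0 < Rabs (x - x0) by apply: Rabs_pos_lt; lra.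
  exists (mkposreal _ hp) => z hz.
  rewrite hg // => ez; move: hz; rewrite ez.
  move=> hz; have : Rabs (x0 - x) < Rabs (x - x0) := hz.
  by rewrite Rabs_minus_sym; lra.
apply: continuous_mult; first exact: hV1c.
apply: continuous_Rinv_comp; last by have hx := hGn x ne => e; apply: hx; lra.
apply: continuous_mult; first exact: continuous_const.
by apply: continuous_of_derive (hGd x).
Qed.

(** * The potential and motion on the circle *)

(** [U y] is the value of the conformal factor at which the potential
    [u ^ 2 - u ^ q] lies [y ^ 2] below its maximum [m ^ 2], on the side of the
    maximum given by the sign of [y], and [H] is the derivative of [U].  On an
    orbit, [y] and a multiple of the velocity run round a circle. *)
Definition phase_chart (q m : R) (U H : R -> R) : Prop :=
  forall y, Rabs y < m ->
    is_derive U y (H y) /\ 0 < H y /\ continuous H y /\ 0 < U y /\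
    U y ^ 2 - Rpower (U y) q = m ^ 2 - y ^ 2 /\
    y = - H y * (U y - q / 2 * Rpower (U y) (q - 1)).

(** In the variable [x = ln u] the potential is [exp (2 x) - exp (q x)], whose
    maximum at [x0] is strict and nondegenerate; [U] is [exp] of the inverse of
    its Morse coordinate.  The value [H 0] is what produces the critical length
    [2 PI / sqrt (n - 2)], and small values of [U] correspond to orbits close
    to the homoclinic one. *)
Lemma energy_chart (q : R) : 2 < q ->
  exists (m : R) (U H : R -> R), 0 < m /\
    phase_chart q m U H /\
    H 0 = / sqrt (q - 2) /\
    (forall d, 0 < d -> exists y, - m < y <= 0 /\ U y < d).
Proof.
move=> hq.
pose x0 := ln (2 / q) / (q - 2).
have hx0 : q * exp (q * x0) = 2 * exp (2 * x0).
  have -> : q * x0 = ln (2 / q) + 2 * x0 by rewrite /x0; field; lra.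
  rewrite exp_plus exp_ln; last by apply: Rdiv_lt_0_compat; lra.
  by field; lra.
have hx0n : x0 < 0.
  have h : ln (2 / q) < 0.
    rewrite -ln_1; apply: ln_increasing; first by apply: Rdiv_lt_0_compat; lra.
    by apply/Rlt_div_l; lra.
  have h1 : 0 < / (q - 2) by apply: Rinv_0_lt_compat; lra.
  by rewrite /x0 /Rdiv; nra.
(* the potential, with maximum M at x0 *)
pose W x := exp (2 * x) - exp (q * x).
pose M := W x0.
pose V x := M - W x.
pose V1 x := q * exp (q * x) - 2 * exp (2 * x).
have hE := exp_pos (2 * x0).
have hM : 0 < M by rewrite /M /W; nra.
have hV x : is_derive V x (V1 x) by rewrite /V /W /V1; auto_derive => //; ring.
have hV1 x : is_derive V1 x (q ^ 2 * exp (q * x) - 4 * exp (2 * x)).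
  by rewrite /V1; auto_derive => //; ring.
have hV1c x : continuous V1 x by apply: continuous_of_derive (hV1 x).
have hV10 : V1 x0 = 0 by rewrite /V1; lra.
have hV1s x : V1 x = 2 * exp (2 * x) * (exp ((q - 2) * (x - x0)) - 1).
  rewrite /V1.
  have -> : exp (q * x) = exp ((q - 2) * (x - x0)) * exp (2 * x) * (2 / q).
    have -> : 2 / q = exp ((q - 2) * x0).
      have -> : (q - 2) * x0 = ln (2 / q) by rewrite /x0; field; lra.
      by rewrite exp_ln //; apply: Rdiv_lt_0_compat; lra.
    by rewrite -!exp_plus; f_equal; ring.
  by field; lra.
have hsgn x : x <> x0 -> 0 < V1 x * (x - x0).
  move=> ne; rewrite hV1s.
  have p := exp_pos (2 * x).
  have hqx : 0 < (exp ((q - 2) * (x - x0)) - 1) * (x - x0).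
    case: (Rtotal_order x x0) => [hlt|[//|hlt]].
    - have : exp ((q - 2) * (x - x0)) < exp 0 by apply: exp_increasing; nra.
      by rewrite exp_0; nra.
    - have : exp 0 < exp ((q - 2) * (x - x0)) by apply: exp_increasing; nra.
      by rewrite exp_0; nra.
  nra.
have hv : q ^ 2 * exp (q * x0) - 4 * exp (2 * x0) = 2 * (q - 2) * exp (2 * x0).
  have -> : q ^ 2 * exp (q * x0) = q * (q * exp (q * x0)) by ring.
  by rewrite hx0; ring.
have hvp : 0 < q ^ 2 * exp (q * x0) - 4 * exp (2 * x0) by rewrite hv; nra.
have [|G [g [hGd [hgp [hgc [hG2 [hGg [hG0 hg0]]]]]]]] :=
  morse_coordinate hV hV1c (hV1 x0) hvp _ hV10 hsgn.
  by rewrite /V /M; ring.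
have hGinc x x' : x < x' -> G x < G x'.
  by move=> h; apply: (@lt_of_derive_gt0 G g) => // *.
have hGinj x x' : G x = G x' -> x = x'.
  by move=> e; case: (Rtotal_order x x') => [/hGinc|[//|/hGinc]]; lra.
pose m := sqrt M.
have hm : 0 < m by apply: sqrt_lt_R0.
have hm2 : m ^ 2 = M by rewrite /m pow2_sqrt; lra.
have hG00 : G 0 = m.
  have h : G x0 < G 0 := hGinc _ _ hx0n.
  have h1 := hG2 0; rewrite /V /W !Rmult_0_r exp_0 in h1.
  have : (G 0 - m) * (G 0 + m) = 0 by rewrite -hm2 in h1; nra.
  by move=> h2; case: (Rmult_integral _ _ h2) => h3; lra.
have hWp x : x < 0 -> 0 < W x.
  move=> hx; have : exp (q * x) < exp (2 * x) by apply: exp_increasing; nra.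
  by rewrite /W; lra.
have hGm x : x < 0 -> Rabs (G x) < m.
  move=> hx; have := hWp x hx; have := hG2 x; rewrite /V => h1 h2.
  have : G x ^ 2 < m ^ 2 by lra.
  by move=> h3; apply: Rabs_def1; nra.
(* the Morse coordinate reaches every y with |y| < m on the half line x < 0 *)
have hGex y : Rabs y < m -> exists x, G x = y.
  move=> /Rabs_def2 hy.
  have hp : 0 < M - y ^ 2 by rewrite -hm2; nra.
  pose z := Rmin x0 (ln (M - y ^ 2) / 2) - 1.
  have z1 : z < x0 by rewrite /z; have := Rmin_l x0 (ln (M - y ^ 2) / 2); lra.
  have z2 : 2 * z < ln (M - y ^ 2).
    by rewrite /z; have := Rmin_r x0 (ln (M - y ^ 2) / 2); lra.
  have z3 : exp (2 * z) < M - y ^ 2.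
    by rewrite -(exp_ln _ hp); apply: exp_increasing.
  have hz : G z <= y.
    have h1 := hGinc _ _ z1; have h2 := hG2 z; have := exp_pos (q * z).
    rewrite /V /W in h2 => h3.
    have h4 : y ^ 2 < G z ^ 2 by lra.
    by nra.
  have hGc : continuity G.
    by apply: continuity_of_continuous => x; apply: continuous_of_derive (hGd x).
  have hz0 := hGinc z 0 ltac:(lra).
  have [|x [_ hx]] := @IVT_gen G z 0 y hGc.
    by rewrite Rmin_left ?Rmax_right; lra.
  by exists x.
have [K hK] : exists K : R -> R, forall y, Rabs y < m -> G (K y) = y.
  apply: (@functional_choice _ _ (fun y x => Rabs y < m -> G x = y)) => y.
  case: (Rlt_or_le (Rabs y) m) => h; last by exists 0; lra.
  by have [x hx] := hGex y h; exists x.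
have hKd y : Rabs y < m -> is_derive K y (/ g (K y)).
  move=> hy; apply: (@is_derive_right_inverse G g) => //.
  exists (m - Rabs y); split=> [|z hz]; first lra.
  apply: hK; have := Rabs_triang_inv z y; lra.
have hKG x : x < 0 -> K (G x) = x.
  by move=> hx; apply: hGinj; apply/hK/hGm.
exists m, (fun y => exp (K y)), (fun y => exp (K y) / g (K y)).
split=> //; split; last split.
- move=> y hy.
  have hgp' := hgp (K y).
  split.
    auto_derive; first by exists (/ g (K y)); apply: hKd.
    by rewrite (is_derive_unique _ _ _ (hKd y hy)) /Rdiv; ring.
  split; first by apply: Rdiv_lt_0_compat; [apply: exp_pos | ].
  have hKc : continuous K y by apply: continuous_of_derive (hKd y hy).
  split.
    apply: continuous_mult.
      apply: continuous_comp => //.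
      by apply: continuous_of_derive; apply: is_derive_exp.
    apply: continuous_Rinv_comp; last lra.
    by apply: continuous_comp.
  split; first exact: exp_pos.
  have hR s : Rpower (exp (K y)) s = exp (s * K y) by rewrite /Rpower ln_exp.
  rewrite !hR; split.
    have := hG2 (K y); rewrite hK // /V /W hm2 => ->.
    have -> : exp (K y) ^ 2 = exp (2 * K y).
      by rewrite /= Rmult_1_r -exp_plus; f_equal; ring.
    by ring.
  have := hGg (K y); rewrite hK // /V1 => h.
  have e1 : exp (q * K y) = exp (K y) * exp ((q - 1) * K y).
    by rewrite -exp_plus; f_equal; ring.
  have e2 : exp (2 * K y) = exp (K y) * exp (K y).
    by rewrite -exp_plus; f_equal; ring.
  rewrite e1 e2 in h.
  apply: (Rmult_eq_reg_r (2 * g (K y))); last lra.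
  have -> : y * (2 * g (K y)) = 2 * y * g (K y) by ring.
  by rewrite h; field; lra.
- have h0 : Rabs 0 < m by rewrite Rabs_R0.
  have -> : K 0 = x0 by apply: hGinj; rewrite hK // hG0.
  rewrite hg0 hv.
  have -> : 2 * (q - 2) * exp (2 * x0) / 2 = (q - 2) * (exp x0) ^ 2.
    have -> : exp x0 ^ 2 = exp (2 * x0).
      by rewrite /= Rmult_1_r -exp_plus; f_equal; ring.
    by field.
  rewrite sqrt_mult ?sqrt_pow2; try lra.
  + have h1 := exp_pos x0.
    have h2 : 0 < sqrt (q - 2) by apply: sqrt_lt_R0; lra.
    by field; lra.
  + by left; apply: exp_pos.
  + exact: pow2_ge_0.
- move=> d hd.
  pose x := Rmin x0 (ln d) - 1.
  have h1 : x < x0 by rewrite /x; have := Rmin_l x0 (ln d); lra.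
  have h2 : x < ln d by rewrite /x; have := Rmin_r x0 (ln d); lra.
  exists (G x); split.
    have := hGm x ltac:(lra) => /Rabs_def2.
    have := hGinc _ _ h1; lra.
  rewrite hKG; last lra.
  by rewrite -(exp_ln _ hd); apply: exp_increasing.
Qed.

Lemma chart_increasing (q m : R) (U H : R -> R) (y z : R) :
  phase_chart q m U H -> - m < y -> y < z -> z < m -> U y < U z.
Proof.
move=> hch hy hyz hz.
apply: (@lt_of_derive_gt0 U H) => // x hx.
  by have [] := hch x ltac:(apply: Rabs_def1; lra).
by have [_ []] := hch x ltac:(apply: Rabs_def1; lra).
Qed.

Lemma const_of_derive0 (f : R -> R) :
  (forall x, is_derive f x 0) -> forall x y, f x = f y.
Proof.
move=> hd x y.
have [||c [_ e]] := MVT_gen f x y (fun=> 0) => //; last lra.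
by move=> z _; apply/continuity_pt_filterlim/(continuous_of_derive (hd z)).
Qed.

(** The flow on the circle with angular speed [/ h] has the explicit time
    function [RInt h 0], so it is solved by inverting an integral, and one turn
    takes the time [RInt h 0 (2 * PI)]. *)
Lemma circle_clock (h : R -> R) :
  (forall s, continuous h s) -> (forall s, 0 < h s) ->
  (forall s, h (s + 2 * PI) = h s) ->
  exists th : R -> R,
    (forall t, is_derive th t (/ h (th t))) /\
    (forall t, th (t + RInt h 0 (2 * PI)) = th t + 2 * PI) /\
    (forall s, exists t, th t = s).
Proof.
move=> hc hp hper.
pose F : R -> R := fun s => RInt h 0 s.
have hFd s : is_derive F s (h s).
  apply: is_derive_RInt; last exact: hc.
  exists (mkposreal 1 Rlt_0_1) => y _.
  by apply: RInt_correct; apply: ex_RInt_continuous => z _; apply: hc.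
have hinc x x' : x < x' -> F x < F x'.
  by move=> hx; apply: (@lt_of_derive_gt0 F h).
have hinj x x' : F x = F x' -> x = x'.
  by move=> e; case: (Rtotal_order x x') => [/hinc|[//|/hinc]]; lra.
have F0 : F 0 = 0 by rewrite /F RInt_point.
have hFper s : F (s + 2 * PI) = F s + F (2 * PI).
  have hd x : is_derive (fun z => F (z + 2 * PI) - F z) x 0.
    auto_derive; first by split; [exists (h (x + 2 * PI)) | split=> //; exists (h x)].
    by rewrite (is_derive_unique _ _ _ (hFd x)) (is_derive_unique _ _ _ (hFd (x + 2 * PI))) hper; ring.
  by have := const_of_derive0 hd s 0; rewrite /= F0 Rplus_0_l; lra.
set P := F (2 * PI) in hFper.
have hP : 0 < P by rewrite -F0; apply: hinc; have := PI_RGT_0; lra.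
have hFN N : F (INR N * (2 * PI)) = INR N * P /\ F (- (INR N * (2 * PI))) = - (INR N * P).
  elim: N => [|N [i1 i2]]; first by rewrite /= !Rmult_0_l !Ropp_0.
  rewrite S_INR; split.
    have -> : (INR N + 1) * (2 * PI) = INR N * (2 * PI) + 2 * PI by ring.
    by rewrite hFper i1; ring.
  have := hFper (- ((INR N + 1) * (2 * PI))).
  have -> : - ((INR N + 1) * (2 * PI)) + 2 * PI = - (INR N * (2 * PI)) by ring.
  by rewrite i2; lra.
have hsurj t : exists s, F s = t.
  have [N hN] := INR_unbounded (Rabs t / P).
  have hN1 : Rabs t < INR N * P by apply/Rlt_div_l.
  have [i1 i2] := hFN N.
  have hF : continuity F.
    by apply: continuity_of_continuous => x; apply: continuous_of_derive (hFd x).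
  have /Rabs_def2 ht := hN1.
  have [|s [_ e]] := @IVT_gen F (- (INR N * (2 * PI))) (INR N * (2 * PI)) t hF.
    by rewrite i1 i2 Rmin_left ?Rmax_right; lra.
  by exists s.
have [th hth] := functional_choice (fun t s => F s = t) hsurj.
exists th; split.
  move=> t; apply: (@is_derive_right_inverse F h) => //.
  by exists 1; split=> //; lra.
split.
  by move=> t; apply: hinj; rewrite hFper !hth.
by move=> s; exists (F s); apply: hinj; rewrite hth.
Qed.

(** * Orbits and their periods *)

(** The period of the orbit of amplitude [r], multiplied by [sqrt a]. *)
Definition angle_integral (H : R -> R) (r : R) : R :=
  RInt (fun s => H (r * sin s)) 0 (2 * PI).

Lemma amplitude_bound (r m s : R) : Rabs r < m -> Rabs (r * sin s) < m.
Proof.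
move=> hr; rewrite Rabs_mult.
have h1 : Rabs (sin s) <= 1 by apply: Rabs_le; have := SIN_bound s; lra.
have := Rabs_pos (sin s); have := Rabs_pos r; nra.
Qed.

Lemma integrand_continuous (H : R -> R) (m r : R) :
  (forall y, Rabs y < m -> continuous H y) -> Rabs r < m ->
  forall s, continuous (fun s => H (r * sin s)) s.
Proof.
move=> hH hr s.
apply: (continuous_comp (fun s => r * sin s) H); last first.
  by apply: hH; apply: amplitude_bound.
by apply: (@continuous_of_derive _ _ (r * cos s)); auto_derive => //; ring.
Qed.

Lemma angle_integral_continuous (H : R -> R) (m r : R) :
  (forall y, Rabs y < m -> continuous H y) -> Rabs r < m ->
  continuous (angle_integral H) r.
Proof.
move=> hH hr; apply/continuous_epsP => eps he.
have hpi := PI_RGT_0.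
pose R0 := (Rabs r + m) / 2.
have hu : uniform_continuity H (fun c => - R0 <= c <= R0).
  apply: Heine; first exact: compact_P3.
  move=> x hx; apply/continuity_pt_filterlim/hH.
  have : Rabs x <= R0 by apply: Rabs_le.
  by rewrite /R0; lra.
have he2 : 0 < eps / (4 * PI) by apply: Rdiv_lt_0_compat; lra.
have [d hd] := hu (mkposreal _ he2).
exists (Rmin d (R0 - Rabs r)); split.
  by apply: Rmin_pos; [exact: cond_pos | rewrite /R0; lra].
move=> r' hr'.
have l1 := Rmin_l d (R0 - Rabs r); have l2 := Rmin_r d (R0 - Rabs r).
have hr2 : Rabs r' < R0.
  have := Rabs_triang_inv r' r; lra.
have hrm : Rabs r' < m by move: hr2; rewrite /R0; lra.
have i1 : ex_RInt (fun s => H (r' * sin s)) 0 (2 * PI).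
  by apply: ex_RInt_continuous => z _; apply: (integrand_continuous hH).
have i2 : ex_RInt (fun s => H (r * sin s)) 0 (2 * PI).
  by apply: ex_RInt_continuous => z _; apply: (integrand_continuous hH).
have -> : angle_integral H r' - angle_integral H r =
    RInt (fun s => H (r' * sin s) - H (r * sin s)) 0 (2 * PI).
  by rewrite (RInt_minus _ _ _ _ i1 i2).
apply: (Rle_lt_trans _ ((2 * PI - 0) * (eps / (4 * PI)))).
  apply: abs_RInt_le_const; first lra.
    exact: ex_RInt_minus.
  move=> s _; left; apply: hd.
  - have := @amplitude_bound r' R0 s ltac:(lra) => /Rabs_def2; lra.
  - have := @amplitude_bound r R0 s ltac:(rewrite /R0; lra) => /Rabs_def2; lra.
  have -> : r' * sin s - r * sin s = (r' - r) * sin s by ring.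
  by apply: amplitude_bound; lra.
have -> : (2 * PI - 0) * (eps / (4 * PI)) = eps / 2 by field; lra.
lra.
Qed.

(** Put [y = r sin th] and [u' = A r cos th], which is conservation of energy.
    Then [u = U y] requires the angular speed [A / H (r sin th)], and the last
    identity of [phase_chart] turns the derivative of [A r cos th] into the
    second order equation. *)
Lemma phase_solution (q m A r : R) (U H : R -> R) :
  phase_chart q m U H -> 0 < A -> 0 <= r < m ->
  exists u u1 : R -> R,
    (forall t, is_derive u t (u1 t)) /\
    (forall t, is_derive u1 t (A ^ 2 * (u t - q / 2 * Rpower (u t) (q - 1)))) /\
    (forall t, 0 < u t) /\
    (forall t, u (t + angle_integral H r / A) = u t) /\
    (forall t, U (- r) <= u t <= U r) /\ (exists t, u t = U r).
Proof.
move=> hch hA hr.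
have hrm : Rabs r < m by rewrite Rabs_pos_eq; lra.
have hb s := amplitude_bound s hrm.
have hHc y : Rabs y < m -> continuous H y by move=> /hch [_ [_ []]].
pose h s := / A * H (r * sin s).
have hp s : 0 < h s.
  apply: Rmult_lt_0_compat; first exact: Rinv_0_lt_compat.
  by have [_ []] := hch _ (hb s).
have [||th [hd [hper hsurj]]] := @circle_clock h _ hp _.
- move=> s; apply: continuous_mult; first exact: continuous_const.
  exact: (integrand_continuous hHc).
- by move=> s; rewrite /h sin_plus cos_2PI sin_2PI; do 3 f_equal; ring.
have hP : RInt h 0 (2 * PI) = angle_integral H r / A.
  rewrite /h RInt_scal; first by rewrite /scal /= /mult /= /angle_integral; field; lra.
  by apply: ex_RInt_continuous => z _; apply: (integrand_continuous hHc).
rewrite hP in hper.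
exists (fun t => U (r * sin (th t))), (fun t => A * r * cos (th t)).
have hU t : is_derive U (r * sin (th t)) (H (r * sin (th t))).
  by have [] := hch _ (hb (th t)).
have hH t : 0 < H (r * sin (th t)) by have [_ []] := hch _ (hb (th t)).
split.
  move=> t; auto_derive.
    by split; [exists (H (r * sin (th t))) | split=> //; exists (/ h (th t))].
  rewrite (is_derive_unique _ _ _ (hU t)) (is_derive_unique _ _ _ (hd t)) /h.
  by have hn := hH t; field; lra.
split.
  move=> t; auto_derive; first by exists (/ h (th t)).
  rewrite (is_derive_unique _ _ _ (hd t)) /h.
  have [_ [_ [_ [_ [_ e]]]]] := hch _ (hb (th t)).
  have hn := hH t.
  have -> : A * r * (1 * / (/ A * H (r * sin (th t))) * - sin (th t)) =
    - (A ^ 2 * (r * sin (th t)) / H (r * sin (th t))) by field; lra.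
  by rewrite {1}e; field; lra.
split; first by move=> t; have [_ [_ [_ []]]] := hch _ (hb (th t)).
split; first by move=> t; rewrite hper sin_plus cos_2PI sin_2PI; f_equal; ring.
split.
  move=> t.
  have hs := SIN_bound (th t).
  have hle : r * sin (th t) <= r by nra.
  have hge : - r <= r * sin (th t) by nra.
  have /Rabs_def2 hbt := hb (th t).
  split.
    case: hge => [hlt|<-]; last lra.
    by left; apply: (chart_increasing hch); lra.
  case: hle => [hlt|->]; last lra.
  by left; apply: (chart_increasing hch); lra.
by have [t e] := hsurj (PI / 2); exists t; rewrite e sin_PI2 Rmult_1_r.
Qed.

(** On the descending half turn, [ln u] decreases at most as fast as time in
    units of [1 / sqrt a] increases, because conservation of energy gives
    [|r cos th| <= u].  A half turn leads from [U r] to [U (- r)]. *)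
Lemma angle_integral_ge (q m r : R) (U H : R -> R) :
  phase_chart q m U H -> 0 <= r < m ->
  ln (U r) - ln (U (- r)) <= angle_integral H r.
Proof.
move=> hch hr.
have hpi := PI_RGT_0.
have hrm : Rabs r < m by rewrite Rabs_pos_eq; lra.
have hb s := amplitude_bound s hrm.
have hHc y : Rabs y < m -> continuous H y by move=> /hch [_ [_ []]].
pose F : R -> R := fun s => RInt (fun s => H (r * sin s)) 0 s.
have hFd s : is_derive F s (H (r * sin s)).
  apply: (is_derive_RInt (fun s => H (r * sin s)) F 0 s); last first.
    exact: (integrand_continuous hHc).
  exists (mkposreal 1 Rlt_0_1) => y _.
  by apply: RInt_correct; apply: ex_RInt_continuous => z _; apply: (integrand_continuous hHc).
have hH s : 0 < H (r * sin s) by have [_ []] := hch _ (hb s).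
have hFinc a b : a < b -> F a < F b.
  by move=> hab; apply: (@lt_of_derive_gt0 F (fun s => H (r * sin s))).
have hU s : is_derive U (r * sin s) (H (r * sin s)) by have [] := hch _ (hb s).
have hUp s : 0 < U (r * sin s) by have [_ [_ [_ []]]] := hch _ (hb s).
(* F measures time; D is time plus ln u along the orbit *)
pose D s := F s + ln (U (r * sin s)).
pose D1 s := H (r * sin s) / U (r * sin s) * (U (r * sin s) + r * cos s).
have hD : D (PI / 2) <= D (3 * (PI / 2)).
  apply: (@le_of_derive_ge0 D D1); first lra.
    move=> s _; rewrite /D /D1; auto_derive.
      split; first by exists (H (r * sin s)).
      by split; [exists (H (r * sin s)) | split].
    rewrite (is_derive_unique _ _ _ (hU s)) (is_derive_unique _ _ _ (hFd s)).
    by have h1 := hUp s; field; lra.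
  move=> s _; rewrite /D1; apply: Rmult_le_pos.
    by left; apply: Rdiv_lt_0_compat.
  have [_ [_ [_ [h1 [h2 _]]]]] := hch _ (hb s).
  have h3 : 0 < Rpower (U (r * sin s)) q by apply: exp_pos.
  have h4 := sin2_cos2 s; rewrite /Rsqr in h4.
  have h5 : (r * cos s) ^ 2 = r ^ 2 - (r * sin s) ^ 2.
    have -> : r ^ 2 = r ^ 2 * (sin s * sin s + cos s * cos s) by rewrite h4; ring.
    by ring.
  have h6 : r ^ 2 < m ^ 2 by nra.
  have h7 : (r * cos s) ^ 2 < U (r * sin s) ^ 2 by lra.
  have : Rabs (r * cos s) <= Rabs (U (r * sin s)) by apply: Rsqr_le_abs_0; rewrite !Rsqr_pow2; lra.
  rewrite (Rabs_pos_eq (U _)); last lra.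
  by have := Rabs_maj2 (r * cos s); lra.
move: hD; rewrite /D.
have -> : 3 * (PI / 2) = PI / 2 + PI by field.
have e3 : sin (PI / 2 + PI) = -1 by rewrite neg_sin sin_PI2.
rewrite e3 sin_PI2 Rmult_1_r.
have -> : r * -1 = - r by ring.
have h1 : F 0 < F (PI / 2) by apply: hFinc; lra.
have h2 : F (PI / 2 + PI) < F (2 * PI) by apply: hFinc; lra.
have h0 : F 0 = 0 by rewrite /F RInt_point.
rewrite /angle_integral -/(F (2 * PI)); lra.
Qed.

(** The period is continuous in the amplitude and, by [angle_integral_ge],
    unbounded as the minimum of [u] tends to [0]. *)
Lemma angle_integral_onto (q m : R) (U H : R -> R) (L : R) :
  0 < m -> phase_chart q m U H ->
  (forall d, 0 < d -> exists y, - m < y <= 0 /\ U y < d) ->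
  angle_integral H 0 < L -> exists r, 0 <= r < m /\ angle_integral H r = L.
Proof.
move=> hm hch hsmall hL.
have hHc y : Rabs y < m -> continuous H y by move=> /hch [_ [_ []]].
have h0 : Rabs 0 < m by rewrite Rabs_R0.
have hU0 : 0 < U 0 by have [_ [_ [_ []]]] := hch _ h0.
have [|y [hy hUy]] := hsmall (U 0 * exp (- (L + 1))).
  by apply: Rmult_lt_0_compat => //; apply: exp_pos.
have hr : 0 <= - y < m by lra.
have hyp : 0 < U y by have [_ [_ [_ []]]] := hch y ltac:(apply: Rabs_def1; lra).
have big : L < angle_integral H (- y).
  have := angle_integral_ge hch hr; rewrite Ropp_involutive.
  have h1 : ln (U y) < ln (U 0) - (L + 1).
    have -> : ln (U 0) - (L + 1) = ln (U 0 * exp (- (L + 1))).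
      rewrite ln_mult ?ln_exp; [by ring | by [] | exact: exp_pos].
    exact: ln_increasing.
  have h2 : ln (U 0) <= ln (U (- y)).
    case: (proj1 hr) => [hlt|<-]; last lra.
    by left; apply: ln_increasing => //; apply: (chart_increasing hch); lra.
  lra.
have hlt : 0 < - y.
  by case: (proj1 hr) => // e; rewrite -e in big; lra.
have [||| r [hr1 hr2]] := IVT_interv (fun r => angle_integral H r - L) 0 (- y) _ hlt.
- move=> a ha; apply/continuity_pt_filterlim.
  apply: (continuous_minus (angle_integral H) (fun=> L)); last exact: continuous_const.
  by apply: (@angle_integral_continuous _ m) => //; rewrite Rabs_pos_eq; lra.
- lra.
- lra.
by exists r; split; lra.
Qed.

Lemma angle_integral_0 (H : R -> R) : angle_integral H 0 = 2 * PI * H 0.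
Proof.
rewrite /angle_integral (RInt_ext _ (fun=> H 0)) => [|s _]; last by rewrite Rmult_0_l.
by rewrite RInt_const /scal /= /mult /=; ring.
Qed.

(** * Smoothness of solutions *)

(** Iterated differentiability on the whole line, in a form closed under sums
    and products by plain induction. *)
Fixpoint times_derivable (m : nat) (f : R -> R) : Prop :=
  if m is k.+1 then
    exists f' : R -> R, (forall t, is_derive f t (f' t)) /\ times_derivable k f'
  else True.

Lemma times_derivableW (m : nat) (f : R -> R) :
  times_derivable m.+1 f -> times_derivable m f.
Proof.
elim: m f => [//|m IH] f [f' [hd h]].
by exists f'; split=> //; apply: IH.
Qed.

Lemma times_derivable_plus (m : nat) (f g : R -> R) :
  times_derivable m f -> times_derivable m g ->
  times_derivable m (fun t => f t + g t).
Proof.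
elim: m f g => [//|m IH] f g [f' [hf h1]] [g' [hg h2]].
exists (fun t => f' t + g' t); split; last exact: IH.
by move=> t; apply: (is_derive_plus f g).
Qed.

Lemma times_derivable_const (m : nat) (c : R) : times_derivable m (fun=> c).
Proof.
elim: m c => [//|m IH] c; exists (fun=> 0); split=> // t.
exact: is_derive_const.
Qed.

Lemma times_derivable_mult (m : nat) (f g : R -> R) :
  times_derivable m f -> times_derivable m g ->
  times_derivable m (fun t => f t * g t).
Proof.
elim: m f g => [//|m IH] f g Hf Hg.
have hf0 := times_derivableW Hf; have hg0 := times_derivableW Hg.
case: Hf => f' [hf h1]; case: Hg => g' [hg h2].
exists (fun t => f' t * g t + f t * g' t); split.
  by move=> t; apply: (is_derive_mult f g) => // x y; apply: Rmult_comm.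
by apply: times_derivable_plus; apply: IH.
Qed.

Lemma ex_derive_n_times_derivable (m : nat) (f : R -> R) :
  times_derivable m f -> forall t, ex_derive_n f m t.
Proof.
elim: m f => [//|[|m] IH] f [f' [hd h]] t; first by exists (f' t).
apply: (ex_derive_ext (Derive_n f' m)); last exact: IH.
move=> z; rewrite -addn1 -(Derive_n_comp f m 1).
by apply: Derive_n_ext => y; rewrite /= (is_derive_unique _ _ _ (hd y)).
Qed.

Lemma is_derive_Rpower_comp (u : R -> R) (t u' e : R) :
  is_derive u t u' -> 0 < u t ->
  is_derive (fun s => Rpower (u s) e) t (e * Rpower (u t) (e - 1) * u').
Proof.
move=> hd hp; rewrite /Rpower; auto_derive; first by split; [exists u' | split].
rewrite (is_derive_unique _ _ _ hd) -/(Rpower (u t) e) -/(Rpower (u t) (e - 1)).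
rewrite /Rminus Rpower_plus Rpower_Ropp Rpower_1 //.
by field; lra.
Qed.

(** All real powers of [u], together with [u] and [u1], have derivatives in the
    algebra that they generate, so they gain one derivative at a time. *)
Lemma smooth_of_ode (u u1 : R -> R) (a b p : R) :
  (forall t, is_derive u t (u1 t)) ->
  (forall t, is_derive u1 t (a * u t - b * Rpower (u t) p)) ->
  (forall t, 0 < u t) -> smooth u.
Proof.
move=> hu hu1 hp m; apply: ex_derive_n_times_derivable.
suff : (forall e, times_derivable m (fun t => Rpower (u t) e)) /\
  times_derivable m u /\ times_derivable m u1 by case=> _ [].
elim: m => [//|m [he [h0 h1]]]; split; last split.
- move=> e; exists (fun t => e * Rpower (u t) (e - 1) * u1 t); split.
    by move=> t; apply: is_derive_Rpower_comp.
  apply: times_derivable_mult => //; apply: times_derivable_mult => //.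
  exact: times_derivable_const.
- by exists u1.
- exists (fun t => a * u t + - b * Rpower (u t) p); split.
    move=> t; have := hu1 t; by have -> : a * u t - b * Rpower (u t) p = a * u t + - b * Rpower (u t) p by ring.
  by apply: times_derivable_plus; apply: times_derivable_mult => //;
    apply: times_derivable_const.
Qed.

(** * Rigidity of short periods *)

(** Two identities are combined.  Multiplying the equation by [u''] and by
    [p u'^2 / u] and adding shows that [u''^2 + p u'^4 / (3 u^2) -
    (p - 1) a u'^2] is the derivative of [u' u'' - p u'^3 / (3 u)].  Writing
    [h = u' - kappa], the square of [u'' + w h tan] is [u''^2 - w^2 h^2] plus
    the derivative of [w h^2 tan], where the tangent is taken at [w] times the
    distance to the midpoint; this is a local form of the Wirtinger inequality,
    whose boundary terms vanish with [h]. *)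
Lemma half_period_estimate (u u1 E : R -> R) (a b p w L s kappa : R) :
  (forall t, is_derive u t (u1 t)) ->
  (forall t, is_derive u1 t (a * u t - b * Rpower (u t) p)) ->
  (forall t, 0 < u t) ->
  (forall t, is_derive E t (p / 3 * (u1 t ^ 4 / u t ^ 2) -
     ((p - 1) * a - w ^ 2) * u1 t ^ 2)) ->
  0 < L -> 0 < w -> w * L < PI -> u1 s = kappa -> u1 (s + L) = kappa ->
  let Q t := u1 t * (a * u t - b * Rpower (u t) p) - p / 3 * (u1 t ^ 3 / u t)
    + 2 * w ^ 2 * kappa * u t in
  E (s + L) - E s <= Q (s + L) - Q s.
Proof.
move=> hu hu1 hp hE hL hw hwL k0 k1 Q.
pose mid := s + L / 2.
pose M t := Q t + w * (u1 t - kappa) ^ 2 * tan (w * (t - mid)) - E t.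
pose M1 t := (a * u t - b * Rpower (u t) p +
    w * (u1 t - kappa) * tan (w * (t - mid))) ^ 2 + w ^ 2 * kappa ^ 2.
have hM : M s <= M (s + L).
  apply: (@le_of_derive_ge0 M M1); first lra.
    move=> t ht.
    have hang : - (PI / 2) < w * (t - mid) < PI / 2 by rewrite /mid; nra.
    have hcos : 0 < cos (w * (t - mid)) by apply: cos_gt_0; lra.
    pose P z := Rpower (u z) p.
    rewrite /M /Q /M1 -/(P t).
    have hP : is_derive P t (p * (P t / u t) * u1 t).
      suff -> : P t / u t = Rpower (u t) (p - 1) by apply: is_derive_Rpower_comp.
      by rewrite /Rminus Rpower_plus Rpower_Ropp Rpower_1.
    pose Tn z := tan (w * (z - mid)).
    have hTn : is_derive Tn t (w * (1 + Tn t ^ 2)).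
      have hsc := sin2_cos2 (w * (t - mid)); rewrite /Rsqr in hsc.
      have hcn : cos (w * (t - mid)) <> 0 by lra.
      rewrite /Tn /tan; auto_derive; first by [].
      rewrite -/(Rminus t mid).
      have -> : w * (1 + (sin (w * (t - mid)) / cos (w * (t - mid))) ^ 2) =
        w * (sin (w * (t - mid)) * sin (w * (t - mid)) +
             cos (w * (t - mid)) * cos (w * (t - mid))) / cos (w * (t - mid)) ^ 2.
        by field.
      by field.
    rewrite -/(Tn t); have hut := hp t.
    apply: (is_derive_ext (fun z => u1 z * (a * u z - b * P z) - p / 3 * (u1 z ^ 3 / u z)
      + 2 * w ^ 2 * kappa * u z + w * (u1 z - kappa) ^ 2 * Tn z - E z)) => //.
    auto_derive.
      do !split=> //; try lra; try by [exists (u1 t) | eexists; exact: hP |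
        eexists; exact: hu1 | eexists; exact: hE | eexists; exact: hTn].
    rewrite (is_derive_unique _ _ _ (hu t)) (is_derive_unique _ _ _ hP)
      (is_derive_unique _ _ _ (hu1 t)) (is_derive_unique _ _ _ (hE t))
      (is_derive_unique _ _ _ hTn) -/(P t).
    by field; lra.
  by move=> t _; rewrite /M1; have := pow2_ge_0 (w * kappa); have := pow2_ge_0 (a * u t - b * Rpower (u t) p +
    w * (u1 t - kappa) * tan (w * (t - mid))); lra.
move: hM; rewrite /M k0 k1 Rminus_diag; lra.
Qed.

Lemma periodic_derive (f f' : R -> R) (T : R) :
  (forall t, is_derive f t (f' t)) -> (forall t, f (t + T) = f t) ->
  forall t, f' (t + T) = f' t.
Proof.
move=> hd hT t.
have e1 : Derive (fun s => f (s + T)) t = Derive f (t + T) := Derive_n_comp_trans f 1 t T.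
have e2 : Derive (fun s => f (s + T)) t = Derive f t by apply: Derive_ext.
rewrite -(is_derive_unique _ _ _ (hd (t + T))) -e1 e2.
exact: is_derive_unique.
Qed.

(** The difference [f (t + L) - f t] changes sign when [t] is shifted by the
    half period [L]. *)
Lemma half_period_coincidence (f : R -> R) (L : R) :
  0 < L -> continuity f -> (forall t, f (t + 2 * L) = f t) ->
  exists c, f (c + L) = f c.
Proof.
move=> hL hf hper.
have hD : continuity (fun t => f (t + L) - f t).
  move=> t; apply: continuity_pt_minus; last exact: hf.
  apply: (continuity_pt_comp (fun s => s + L) f); last exact: hf.
  by apply: derivable_continuous_pt; exists 1; apply/is_derive_Reals; auto_derive => //; ring.
have [|c [_ hc]] := IVT_gen (fun t => f (t + L) - f t) 0 L 0 hD.
  have -> : L + L = 0 + 2 * L by ring.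
  rewrite hper Rplus_0_l /Rmin /Rmax.
  by case: Rle_dec => h; lra.
by exists c; lra.
Qed.

(** Adding [half_period_estimate] over two consecutive half periods that start
    at equal values of [u'], the periodic terms cancel and [F], the primitive
    of [p u'^4 / (3 u^2)], grows over one period by at most
    [((p - 1) a - w^2)] times the integral of [u'^2], for each
    [w < 2 PI / T].  In the limit [w -> 2 PI / T], [F] does not grow, so
    [u'] vanishes. *)
Lemma rigidity (u u1 : R -> R) (T a b p : R) :
  (forall t, is_derive u t (u1 t)) ->
  (forall t, is_derive u1 t (a * u t - b * Rpower (u t) p)) ->
  (forall t, 0 < u t) -> 0 < T -> (forall t, u (t + T) = u t) ->
  0 < p -> (p - 1) * a <= (2 * PI / T) ^ 2 ->
  forall s t, u s = u t.
Proof.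
move=> hu hu1 hp hT hper hpp hbound.
have hper1 := periodic_derive hu hper.
have hpi := PI_RGT_0.
pose f t := p / 3 * (u1 t ^ 4 / u t ^ 2).
have hf0 t : 0 <= f t.
  apply: Rmult_le_pos; first lra.
  apply: Rmult_le_pos; last by left; apply/Rinv_0_lt_compat/pow_lt.
  have -> : u1 t ^ 4 = (u1 t ^ 2) ^ 2 by ring.
  exact: pow2_ge_0.
have hex (h : R -> R) : (forall t, ex_derive h t) ->
    exists I : R -> R, forall t, is_derive I t (h t).
  move=> hh; exists (fun t => RInt h 0 t) => t.
  have hc z : continuous h z by apply: ex_derive_continuous.
  apply: is_derive_RInt; last exact: hc.
  exists (mkposreal 1 Rlt_0_1) => y _.
  by apply: RInt_correct; apply: ex_RInt_continuous => z _.
have [|F hF] := hex f.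
  move=> t; rewrite /f; auto_derive; have := hp t => h.
  do !split=> //; try by [exists (u1 t) | eexists; exact: hu1].
  by apply: Rgt_not_eq; nra.
have [|B hB] := hex (fun t => u1 t ^ 2).
  by move=> t; auto_derive; eexists; exact: hu1.
have hFm x y : x <= y -> F x <= F y.
  by move=> hxy; apply: (@le_of_derive_ge0 F f).
have hBm x y : x <= y -> B x <= B y.
  by move=> hxy; apply: (@le_of_derive_ge0 B (fun t => u1 t ^ 2)) => // z _; apply: pow2_ge_0.
have hL : 0 < T / 2 by lra.
have [||c hc] := @half_period_coincidence u1 _ hL.
- by apply: continuity_of_continuous => z; apply: continuous_of_derive (hu1 z).
- by move=> t; have -> : 2 * (T / 2) = T by field.
have eT : c + T / 2 + T / 2 = c + T by field.
have key w : 0 < w -> w * (T / 2) < PI ->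
    F (c + T) - F c <= ((p - 1) * a - w ^ 2) * (B (c + T) - B c).
  move=> hw hwL.
  pose E t := F t - ((p - 1) * a - w ^ 2) * B t.
  have hE t : is_derive E t (f t - ((p - 1) * a - w ^ 2) * u1 t ^ 2).
    apply: (is_derive_minus F (fun t => ((p - 1) * a - w ^ 2) * B t)) => //.
    exact: is_derive_scal.
  have h1 := half_period_estimate hu hu1 hp hE hL hw hwL erefl hc.
  have hc2 : u1 (c + T / 2 + T / 2) = u1 c by rewrite eT hper1.
  have h2 := half_period_estimate hu hu1 hp hE hL hw hwL hc hc2.
  move: h1 h2; rewrite /= eT hper hper1 /E; lra.
have hFT : F (c + T) <= F c.
  case: (Rle_or_lt (F (c + T)) (F c)) => // hlt; exfalso.
  set X := F (c + T) - F c.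
  have hX : 0 < X by rewrite /X; lra.
  set Y := B (c + T) - B c.
  have hY : 0 <= Y by have := hBm c (c + T); rewrite /Y; lra.
  pose Om := 2 * PI / T.
  have hOm : 0 < Om by apply: Rdiv_lt_0_compat; lra.
  (* w = (1 - eta) Om with eta so small that the excess 2 eta Om^2 Y is below X *)
  pose Z := 4 * Om ^ 2 * (Y + 1).
  have hO2 : 0 < Om ^ 2 by apply: pow_lt.
  have hZ : 0 < Z by rewrite /Z; nra.
  have hXZ : 0 < X / Z by apply: Rdiv_lt_0_compat.
  pose eta := Rmin (1 / 2) (X / Z).
  have e1 : eta <= 1 / 2 by apply: Rmin_l.
  have e2 : eta <= X / Z by apply: Rmin_r.
  have e0 : 0 < eta by apply: Rmin_pos; lra.
  have w0 : 0 < Om * (1 - eta) by apply: Rmult_lt_0_compat; lra.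
  have w1 : Om * (1 - eta) * (T / 2) < PI.
    have -> : Om * (1 - eta) * (T / 2) = PI * (1 - eta) by rewrite /Om; field; lra.
    by nra.
  have := key _ w0 w1; rewrite -/X -/Y => hXY.
  have e3 : eta * Z <= X by apply/Rle_div_r.
  have e4 : (p - 1) * a - (Om * (1 - eta)) ^ 2 <= 2 * eta * Om ^ 2.
    move: hbound; rewrite -/Om => hbound; have := pow2_ge_0 (Om * eta); nra.
  have e5 := Rmult_le_compat_r Y _ _ hY e4.
  have e6 : 0 < eta * Om ^ 2 by apply: Rmult_lt_0_compat.
  rewrite /Z in e3; nra.
have hFper t : F (t + T) = F t.
  have hd x : is_derive (fun z => F (z + T) - F z) x 0.
    auto_derive; first by split; [exists (f (x + T)) | split=> //; exists (f x)].
    rewrite (is_derive_unique _ _ _ (hF x)) (is_derive_unique _ _ _ (hF (x + T))).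
    by rewrite /f hper hper1; ring.
  have := const_of_derive0 hd t c; have := hFm c (c + T); rewrite /=; lra.
have hf t : f t = 0.
  have h0 : is_derive F t 0.
    apply: (is_derive_ext_loc (fun=> F (t - T / 2))); last exact: is_derive_const.
    exists (mkposreal _ hL) => y hy.
    have /Rabs_def2 : Rabs (y - t) < T / 2 := hy.
    move=> hy2.
    have := hFper (t - T / 2); have -> : t - T / 2 + T = t + T / 2 by field.
    have := hFm (t - T / 2) y; have := hFm y (t + T / 2); lra.
  by rewrite -(is_derive_unique _ _ _ (hF t)) (is_derive_unique _ _ _ h0).
have hu10 t : u1 t = 0.
  have := hf t; rewrite /f => e.
  case: (Req_dec (u1 t) 0) => // ne; exfalso.
  have : 0 < u1 t ^ 4 / u t ^ 2.
    apply: Rdiv_lt_0_compat; last exact: pow_lt.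
    have -> : u1 t ^ 4 = (u1 t ^ 2) ^ 2 by ring.
    by apply: pow_lt; apply: pow2_gt_0.
  nra.
by apply: const_of_derive0 => t; rewrite -(hu10 t).
Qed.

(** * Conformal factors and metrics *)

Lemma dot_zero (n : nat) (v : vec n) : dot v (fun=> 0) = 0.
Proof.
apply: (big_ind (fun x => x = 0)) => // [x y -> -> | i _]; lra.
Qed.

Lemma exists_on_sphere (n : nat) : (0 < n)%N -> exists xi : vec n, on_sphere xi.
Proof.
case: n => // n _; exists (fun i => if i == ord0 then 1 else 0).
rewrite /on_sphere /dot big_ord_recl eqxx.
suff -> : \big[Rplus/0]_(i < n) ((if lift ord0 i == ord0 then 1 else 0) *
  (if lift ord0 i == ord0 then 1 else 0)) = 0 by ring.
by apply: (big_ind (fun x => x = 0)) => // [x y -> -> | i _] /=; lra.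
Qed.

Lemma Rpower_inj (x y e : R) :
  0 < x -> 0 < y -> e <> 0 -> Rpower x e = Rpower y e -> x = y.
Proof.
move=> hx hy he /exp_inv h; apply: ln_inv => //.
exact: (Rmult_eq_reg_l e).
Qed.

(** Both metrics are evaluated on the unit vector d/dt. *)
Lemma conformal_factor_eq (n : nat) (u v : R -> R) (tau : R) :
  (3 <= n)%N -> (forall t, 0 < u t) -> (forall t, 0 < v t) ->
  form_eq (@conformal_metric n v) (translate tau (@conformal_metric n u)) ->
  forall t, v t = u (t + tau).
Proof.
move=> hn hu hv h t.
have hN : 3 <= INR n by have := le_INR 3 n (elimT leP hn); rewrite /=; lra.
have [xi hxi] := @exists_on_sphere n (leq_trans (isT : (0 < 3)%N) hn).
have ht : tangent xi (1, fun=> 0) by apply: dot_zero.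
have := h t xi _ _ hxi ht ht.
rewrite /translate /conformal_metric /g0 /= dot_zero !Rmult_1_r Rplus_0_r !Rmult_1_r.
apply: Rpower_inj => //.
by apply: Rgt_not_eq; apply: Rdiv_lt_0_compat; lra.
Qed.

Lemma conformal_constant (n : nat) (u : R -> R) (g : form_field n) :
  form_eq g (@conformal_metric n u) -> (forall t, u t = u 0) ->
  constant_multiple_of_g0 g.
Proof.
move=> h hu; exists (Rpower (u 0) (4 / (INR n - 2))); split; first exact: exp_pos.
by move=> t xi X Y hxi hX hY; rewrite h // /conformal_metric hu.
Qed.

(** * Solutions of prescribed period *)

Lemma periodic_iter (f : R -> R) (P : R) (j : nat) :
  (forall t, f (t + P) = f t) -> forall t, f (t + INR j * P) = f t.
Proof.
move=> h; elim: j => [|j IH] t; first by rewrite /= Rmult_0_l Rplus_0_r.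
by rewrite S_INR Rmult_plus_distr_r Rmult_1_l -Rplus_assoc h IH.
Qed.

Lemma pseudo_cylindric_of_ode (n : nat) (T : R) (u u1 : R -> R) :
  (forall t, is_derive u t (u1 t)) ->
  (forall t, is_derive u1 t ((INR n - 2) ^ 2 / 4 * u t -
     INR n * (INR n - 2) / 4 * Rpower (u t) ((INR n + 2) / (INR n - 2)))) ->
  (forall t, 0 < u t) -> (forall t, u (t + T) = u t) ->
  pseudo_cylindric_factor n T u.
Proof.
move=> hu hu1 hp hT; split=> //; first exact: smooth_of_ode hu hu1 hp.
move=> t.
have -> : Derive_n u 2 t = Derive u1 t.
  by apply: Derive_ext => s; apply: is_derive_unique.
rewrite (is_derive_unique _ _ _ (hu1 t)); ring.
Qed.

Lemma pseudo_cylindric_ode (n : nat) (T : R) (u : R -> R) :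
  pseudo_cylindric_factor n T u ->
  (forall t, is_derive u t (Derive u t)) /\
  (forall t, is_derive (Derive u) t ((INR n - 2) ^ 2 / 4 * u t -
     INR n * (INR n - 2) / 4 * Rpower (u t) ((INR n + 2) / (INR n - 2)))).
Proof.
move=> [hs hp _ hode]; split=> t; first exact: Derive_correct (hs 1%N t).
have <- : Derive (Derive u) t = (INR n - 2) ^ 2 / 4 * u t -
     INR n * (INR n - 2) / 4 * Rpower (u t) ((INR n + 2) / (INR n - 2)).
  by have := hode t; change (Derive_n u 2 t) with (Derive (Derive u) t); lra.
exact: Derive_correct (hs 2%N t).
Qed.

(** For [0 < j < k] the amplitude [r j] is chosen so that [j] periods of the
    orbit have total length [T]; the constant solution has amplitude [0].
    Two of these factors differ by more than a translation because the maximum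
    [U (r j)] determines the amplitude, hence the period, hence [j]. *)
Lemma pseudo_cylindric_family (n k : nat) (T : R) :
  (3 <= n)%N -> (1 <= k)%N -> 0 < T ->
  2 * PI * (INR k - 1) / sqrt (INR n - 2) < T ->
  exists u : nat -> R -> R,
    (forall j, (j < k)%N -> pseudo_cylindric_factor n T (u j)) /\
    (forall i j, (i < k)%N -> (j < k)%N -> i <> j ->
       forall tau, ~ (forall t, u j t = u i (t + tau))) /\
    (forall t, u 0%N t = u 0%N 0).
Proof.
move=> hn hk hT hTlo.
have hN : 3 <= INR n by have := le_INR 3 n (elimT leP hn); rewrite /=; lra.
have hpi := PI_RGT_0.
pose q := 2 * INR n / (INR n - 2).
pose A := (INR n - 2) / 2.
have hA : 0 < A by rewrite /A; lra.
have hq2 : q - 2 = 4 / (INR n - 2) by rewrite /q; field; lra.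
have hq : 2 < q by have : 0 < 4 / (INR n - 2) by [apply: Rdiv_lt_0_compat; lra]; lra.
have [m [U [H [hm [hch [hH0 hsmall]]]]]] := energy_chart hq.
have hsq : sqrt (INR n - 2) = A * sqrt (q - 2).
  have -> : INR n - 2 = A ^ 2 * (q - 2) by rewrite hq2 /A; field; lra.
  rewrite sqrt_mult ?sqrt_pow2; [by [] | lra | exact: pow2_ge_0 | lra].
have hs : 0 < sqrt (q - 2) by apply: sqrt_lt_R0; lra.
(* j periods 2 pi / sqrt (n - 2) of the infinitesimal oscillation fit in T *)
have hlow j : (j < k)%N -> INR j * angle_integral H 0 < A * T.
  move=> hj; rewrite angle_integral_0 hH0.
  have hjk : INR j <= INR k - 1.
    by have := le_INR j.+1 k (elimT leP hj); rewrite S_INR; lra.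
  have h1 : 2 * PI * (INR k - 1) < T * (A * sqrt (q - 2)).
    by rewrite -hsq; apply/Rlt_div_l => //; rewrite hsq; nra.
  apply: (Rmult_lt_reg_r (sqrt (q - 2))) => //.
  have -> : INR j * (2 * PI * / sqrt (q - 2)) * sqrt (q - 2) = 2 * PI * INR j by field; lra.
  nra.
have [r hr] : exists r : nat -> R, forall j, (j < k)%N -> 0 <= r j < m /\
    (j = 0%N -> r j = 0) /\ ((0 < j)%N -> INR j * angle_integral H (r j) = A * T).
  apply: (@functional_choice _ _ (fun j r => (j < k)%N -> 0 <= r < m /\ (j = 0%N -> r = 0) /\
    ((0 < j)%N -> INR j * angle_integral H r = A * T))).
  case=> [|j]; first by exists 0 => _; split; first lra.
  case: (boolP (j.+1 < k)%N) => hj; last by exists 0.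
  have hj0 : 0 < INR j.+1 by rewrite S_INR; have := pos_INR j; lra.
  have [|r [h1 h2]] := angle_integral_onto hm hch hsmall (L := A * T / INR j.+1).
    by apply/Rlt_div_r => //; rewrite Rmult_comm; apply: hlow.
  exists r => _; split=> //; split=> // _.
  by rewrite h2; field; lra.
have [u hu] : exists u : nat -> R -> R, forall j, (j < k)%N ->
    pseudo_cylindric_factor n T (u j) /\
    (forall t, U (- r j) <= u j t <= U (r j)) /\ (exists t, u j t = U (r j)).
  apply: (@functional_choice _ _ (fun j u => (j < k)%N -> pseudo_cylindric_factor n T u /\
    (forall t, U (- r j) <= u t <= U (r j)) /\ (exists t, u t = U (r j)))) => j.
  case: (boolP (j < k)%N) => hj; last by exists (fun=> 0).
  have [h1 [h2 h3]] := hr j hj.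
  have [u [u1 [d1 [d2 [hp [hper [hb hmax]]]]]]] := phase_solution hch hA h1.
  exists u => _; split=> //.
  apply: (@pseudo_cylindric_of_ode _ _ u u1) => // t.
    have e1 : (INR n + 2) / (INR n - 2) = q - 1 by rewrite /q; field; lra.
    rewrite e1.
    have -> : (INR n - 2) ^ 2 / 4 * u t - INR n * (INR n - 2) / 4 * Rpower (u t) (q - 1) =
      A ^ 2 * (u t - q / 2 * Rpower (u t) (q - 1)) by rewrite /A {2}/q; field; lra.
    exact: d2.
  case: j hj h1 h2 h3 hb {hmax hper} (periodic_iter j hper) => [|j] hj h1 h2 h3 hb hper.
    have e0 : r 0%N = 0 by apply: h2.
    move: hb; rewrite e0 Ropp_0 => hb.
    have := hb t; have := hb (t + T); lra.
  have hj0 : 0 < INR j.+1 by rewrite S_INR; have := pos_INR j; lra.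
  rewrite -(hper t); do 2 f_equal.
  have -> : T = A * T / A by field; lra.
  by rewrite -h3 //; field; lra.
exists u; split; last split.
- by move=> j /hu [].
- move=> i j hi hj ne tau heq.
  have [_ [hbi [ti hti]]] := hu i hi.
  have [_ [hbj [tj htj]]] := hu j hj.
  have [hri [h0i hPi]] := hr i hi.
  have [hrj [h0j hPj]] := hr j hj.
  have hUU : U (r i) = U (r j).
    apply: Rle_antisym.
      rewrite -hti; have := heq (ti - tau).
      have -> : ti - tau + tau = ti by ring.
      by move=> <-; case: (hbj (ti - tau)).
    by rewrite -htj heq; case: (hbi (tj + tau)).
  have hrr : r i = r j.
    case: (Rtotal_order (r i) (r j)) => [hlt|[//|hlt]].
      by have := chart_increasing hch _ hlt; lra.
    by have := chart_increasing hch _ hlt; lra.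
  case: i hi ne {heq hbi ti hti hri hUU} h0i hPi hrr => [|i] hi ne h0i hPi hrr.
    case: j hj ne {hbj tj htj hrj h0j} hPj hrr => [//|j] hj ne hPj hrr.
    by have := hlow j.+1 hj; rewrite -(hPj isT) -hrr h0i //; lra.
  case: j hj ne {hbj tj htj hrj} h0j hPj hrr => [|j] hj ne h0j hPj hrr.
    by have := hlow i.+1 hi; rewrite -(hPi isT) hrr h0j //; lra.
  apply: ne; apply: INR_eq.
  have := hPi isT; rewrite hrr -(hPj isT) => e.
  apply: (Rmult_eq_reg_r (angle_integral H (r j.+1))) => // e0.
  have := hPj isT; rewrite e0; nra.
- have [_ [hb _]] := hu _ hk.
  have [_ [h0 _]] := hr _ hk.
  move=> t; have := hb t; have := hb 0; rewrite h0 // Ropp_0; lra.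
Qed.

Unset Implicit Arguments.

Theorem mainTheorem1 (n k : nat) (T : R)
  (hn : (3 <= n)%N) (hk : (1 <= k)%N) (hT : 0 < T)
  (hTlo : 2 * PI * (INR k - 1) / sqrt (INR n - 2) < T)
  (hTup : T <= 2 * PI * INR k / sqrt (INR n - 2)) :
  (exists u : nat -> R -> R,
     (forall j : nat, (j < k)%N -> pseudo_cylindric_factor n T (u j)) /\
     (forall i j : nat, (i < k)%N -> (j < k)%N -> i <> j ->
        ~ translation_related (@conformal_metric n (u i))
                              (@conformal_metric n (u j))) /\
     constant_multiple_of_g0 (@conformal_metric n (u 0%N))) /\
  (k = 1%N ->
     forall g : form_field n,
       pseudo_cylindric_metric T g -> constant_multiple_of_g0 g).
Proof.
have hN : 3 <= INR n by have := le_INR 3 n (elimT leP hn); rewrite /=; lra.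
split.
  have [u [hu [hne h0]]] := pseudo_cylindric_family hn hk hT hTlo.
  exists u; split=> //; split; last exact: (@conformal_constant n (u 0%N)).
  move=> i j hi hj ne [tau h].
  have [_ hpi _ _] := hu i hi; have [_ hpj _ _] := hu j hj.
  exact: (hne i j hi hj ne tau (conformal_factor_eq hn hpi hpj h)).
move=> ek g [u [hu hg]].
have [hd1 hd2] := pseudo_cylindric_ode hu.
have [_ hp hper _] := hu.
apply: (conformal_constant hg) => t.
apply: (rigidity hd1 hd2 hp hT hper).
  by apply: Rdiv_lt_0_compat; lra.
have -> : ((INR n + 2) / (INR n - 2) - 1) * ((INR n - 2) ^ 2 / 4) = INR n - 2 by field; lra.
have hs : 0 < sqrt (INR n - 2) by apply: sqrt_lt_R0; lra.
rewrite -{1}(pow2_sqrt (INR n - 2)); last lra.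
apply: pow_incr; split; first lra.
apply/Rle_div_r => //.
move: hTup; rewrite ek Rmult_1_r => /Rle_div_r; lra.
Qed.
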